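(* Let $\mathcal D\subset\{1,\dots,K\}$ be the (nonempty) set of domain Markov states, let $t$ be a lag time, let $C^{S}(t)$ and $C^{S}(0)$ be the stopped-process correlation matrices, and let $(C^{S}(t)-C^{S}(0))^{\mathcal D}$ denote the matrix $C^{S}(t)-C^{S}(0)$ restricted to rows and columns with indices in $\mathcal D$. Assume that this restricted matrix is invertible. Let $(Y_{lt})_{l\ge0}$ be the Markov chain on $\{1,\dots,K\}$ with one-step transition matrix $T^{S}(t)$. Then the induced matrix $1$-norm of the inverse satisfies $$\left\|\left(\left(C^{S}(t)-C^{S}(0)\right)^{\mathcal D}\right)^{-1}\right\|_1=\max_{j\in\mathcal D}\ \frac{1}{\mu_j}\sum_{i\in\mathcal D}\mathbb E\left[\sum_{l=0}^{\infty}\mathbb 1_{j}(Y_{lt})\ \Big|\ Y_0=i\right],$$ where $\mathbb 1_j(y)=1$ if $y=j$ and $0$ otherwise.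
   Context: Setting. $(X_s)$ is a time-homogeneous discrete-time Markov process on a phase space, taking a step every $\Delta t$ time units; lag times $t$ are positive integer multiples of $\Delta t$. The phase space is partitioned into finitely many disjoint (measurable) sets $S_1,\dots,S_K$, called Markov states. A subset $D$ of phase space (the domain) is fixed, with complement $D^c$ (the boundary states), and each $S_i$ is wholly contained in $D$ or in $D^c$; $\mathcal D$ is the set of indices $i$ with $S_i\subset D$. Let $\tau_{D^c}$ be the first time $s\ge 0$ at which $X_s\in D^c$, and $t\wedge\tau_{D^c}=\min\{t,\tau_{D^c}\}$. The stopped transition operator is $$\mathcal K^{t}_{D^c}f(x)=\mathbb E\left[f(X_{t\wedge\tau_{D^c}})\mid X_0=x\right].$$ Let $\mu$ be a probability density on phase space (the sampling measure), with $\mu_i=\int \mathbb 1_{S_i}(x)\mu(x)\,dx>0$ for every $i$. The stopped-process correlation matrices are $$C^{S}_{ij}(t)=\int \mathbb 1_{S_i}(x)\,\mathcal K^{t}_{D^c}\mathbb 1_{S_j}(x)\,\mu(x)\,dx,\qquad C^{S}_{ij}(0)=\mu_i\delta_{ij},$$ and the stopped-process transition matrix is $T^{S}_{ij}(t)=C^{S}_{ij}(t)/\mu_i$, which is a stochastic matrix. In particular, states with index outside $\mathcal D$ are absorbing for $T^{S}(t)$. The induced matrix $1$-norm is $\|A\|_1=\max_{\|v\|_1=1}\|Av\|_1$, where $\|v\|_1=\sum_i|v_i|$. *)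

(* Defs.v *)
From HB Require Import structures.
From mathcomp Require Import all_boot all_order all_algebra.
From mathcomp Require Import all_classical all_reals all_analysis.

Set Implicit Arguments.
Unset Strict Implicit.
Unset Printing Implicit Defensive.

Import Order.TTheory GRing.Theory Num.Theory.
Import numFieldNormedType.Exports.

Local Open Scope classical_set_scope.
Local Open Scope ring_scope.

(* All times are counted in steps of length Delta t: the natural number n
   stands for the time n * Delta t. *)

Section MarkovProcess.
Context {R : realType} {d d' : measure_display}.
Context {X : measurableType d} {Omega : measurableType d'}.

Definition natural_filtration (Z : nat -> Omega -> X) (n : nat) :
    set (set Omega) :=
  <<s \bigcup_(k in [set k | (k <= n)%N])
        preimage_set_system setT (Z k) measurable >>.

(* [Pr x] is the law conditional on Z_0 = x.  The one-step kernel [p] does not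
   depend on the time n, which is time-homogeneity; the third clause says that
   p (Z_n) B is a version of Pr_x[Z_(n+1) \in B | F_n]. *)
Definition markov_process (p : R.-pker X ~> X) (Pr : R.-pker X ~> Omega)
    (Z : nat -> Omega -> X) : Prop :=
  [/\ forall n, measurable_fun setT (Z n),
      forall x (B : set X), measurable B -> Pr x (Z 0%N @^-1` B) = \d_x B
    & forall x n (F : set Omega) (B : set X),
        natural_filtration Z n F -> measurable B ->
        Pr x (F `&` Z n.+1 @^-1` B) = (\int[Pr x]_(w in F) p (Z n w) B)%E].

End MarkovProcess.

Section StoppedProcess.
Context {R : realType} {d d' : measure_display}.
Context {X : measurableType d} {Omega : measurableType d'}.

(* First time s >= 0 at which the trajectory z is in A; None is infinity. *)
Definition hitting_time (A : set X) (z : nat -> X) : option nat :=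
  if pselect (exists s, `[< A (z s) >]) is left h then Some (ex_minn h)
  else None.

Definition min_time (n : nat) (tau : option nat) : nat :=
  if tau is Some s then minn n s else n.

Definition stopped_operator (Pr : R.-pker X ~> Omega) (Z : nat -> Omega -> X)
    (A : set X) (n : nat) (f : X -> R) (x : X) : R :=
  \int[Pr x]_w f (Z (min_time n (hitting_time A (Z ^~ w))) w).

Definition probability_density (dx : {measure set X -> \bar R})
    (rho : X -> R) : Prop :=
  [/\ measurable_fun setT rho,
      forall x, 0 <= rho x
    & (\int[dx]_x (rho x)%:E = 1)%E].

Context (dx : {measure set X -> \bar R}) (rho : X -> R).
Context {K : nat} (S : 'I_K -> set X).

Definition state_weight (i : 'I_K) : R := \int[dx]_x (\1_(S i) x * rho x).

Definition stopped_correlation (Pr : R.-pker X ~> Omega)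
    (Z : nat -> Omega -> X) (D : set X) (n : nat) : 'M[R]_K :=
  \matrix_(i, j) \int[dx]_x
    (\1_(S i) x * stopped_operator Pr Z (~` D) n \1_(S j) x * rho x).

Definition correlation0 : 'M[R]_K :=
  \matrix_(i, j) (state_weight i *+ (i == j)).

Definition stopped_transition (Pr : R.-pker X ~> Omega)
    (Z : nat -> Omega -> X) (D : set X) (n : nat) : 'M[R]_K :=
  \matrix_(i, j) (stopped_correlation Pr Z D n i j / state_weight i).

Definition domain_states (D : set X) : {set 'I_K} :=
  [set i : 'I_K | `[< S i `<=` D >]]%SET.

End StoppedProcess.

Definition measurable_partition {d : measure_display} {X : measurableType d}
    {K : nat} (S : 'I_K -> set X) : Prop :=
  [/\ forall i, measurable (S i),
      trivIset setT S
    & \bigcup_i S i = setT].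

Definition restrict_mx {R : realType} {K : nat} (I : {set 'I_K})
    (A : 'M[R]_K) : 'M[R]_#|I| :=
  mxsub (fun a : 'I_#|I| => enum_val a) (fun b : 'I_#|I| => enum_val b) A.

Definition norm1 {R : realType} {n : nat} (v : 'cV[R]_n) : R :=
  \sum_(i < n) `|v i 0|.

(* The supremum is a maximum when n > 0. *)
Definition induced_norm1 {R : realType} {n : nat} (A : 'M[R]_n) : R :=
  sup [set norm1 (A *m v) | v in [set v : 'cV[R]_n | norm1 v = 1]].

(* [Q i] is the law conditional on Y_0 = i; the time index l of Y counts
   applications of the one-step matrix T. *)
Definition markov_chain {R : realType} {d : measure_display}
    {Omega : measurableType d} {K : nat} (T : 'M[R]_K)
    (Q : 'I_K -> probability Omega R) (Y : nat -> Omega -> 'I_K) : Prop :=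
  [/\ forall l i, measurable (Y l @^-1` [set i]),
      forall i, Q i (Y 0%N @^-1` [set i]) = 1%E
    & forall i l (y : nat -> 'I_K) j,
        let past := [set w | forall k, (k <= l)%N -> Y k w = y k] in
        Q i (past `&` Y l.+1 @^-1` [set j]) = (Q i past * (T (y l) j)%:E)%E].

(* Main.v *)
(* Let P be the restriction of T^S(t) to the domain states and m the diagonal
   matrix of their weights, so that the restricted difference of correlation
   matrices is m (P - 1).  Since the other states are absorbing, (P^l)_ij is
   the probability of being in j after l steps from i, even though the chain
   may leave the domain; summing over l, the expected numbers of visits are
   the entries of the Neumann series (1 - P)^-1.  These are nonnegative, hence
   the absolute column sums of (m (P - 1))^-1 = - (1 - P)^-1 m^-1 are the
   asserted quantities, and the induced 1-norm is the maximal column sum. *)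
Require Import Defs.
From HB Require Import structures.
From mathcomp Require Import all_boot all_order all_algebra.
From mathcomp Require Import all_classical all_reals all_analysis.
Import Order.TTheory GRing.Theory Num.Theory.
Import numFieldNormedType.Exports HBNNSimple measurable_realfun.
Local Open Scope classical_set_scope.
Local Open Scope ring_scope.

Set Implicit Arguments.
Unset Strict Implicit.
Unset Printing Implicit Defensive.

(** * Matrix analysis: the induced 1-norm and the Neumann series *)

Lemma norm1_delta (R : realType) (n : nat) (j : 'I_n) :
  norm1 (delta_mx j 0 : 'cV[R]_n) = 1.
Proof.
rewrite /norm1 (bigD1 j) //= mxE !eqxx normr1 big1 ?addr0 // => i /negbTE ij.
by rewrite mxE ij normr0.
Qed.

Lemma norm1_mulmx_delta (R : realType) (n : nat) (A : 'M[R]_n) (j : 'I_n) :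
  norm1 (A *m delta_mx j 0) = \sum_i `|A i j|.
Proof. by rewrite -colE; apply: eq_bigr => i _; rewrite mxE. Qed.

Lemma norm1_mulmx_le (R : realType) (n : nat) (A : 'M[R]_n) (c : R)
    (v : 'cV[R]_n) :
  (forall j, \sum_i `|A i j| <= c) -> norm1 (A *m v) <= c * norm1 v.
Proof.
move=> Ac; rewrite /norm1 mulr_sumr.
apply: (@le_trans _ _ (\sum_i \sum_j `|A i j| * `|v j 0|)).
  apply: ler_sum => i _; rewrite mxE.
  by under [leRHS]eq_bigr do rewrite -normrM; exact: ler_norm_sum.
rewrite exchange_big; apply: ler_sum => j _ /=.
by rewrite -mulr_suml ler_wpM2r.
Qed.

(** The basis vector [delta_mx j0 0] attains the bound by the largest column sum. It also shows that
    the set under [sup] is nonempty. *)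
Lemma induced_norm1_eq_max (R : realType) (n : nat) (A : 'M[R]_n) (j0 : 'I_n) :
  (forall j, \sum_i `|A i j| <= \sum_i `|A i j0|) ->
  induced_norm1 A = \sum_i `|A i j0|.
Proof.
move=> Aj0; apply/le_anti/andP; split.
  apply: ge_sup.
    exists (norm1 (A *m delta_mx j0 0)), (delta_mx j0 0) => //.
    exact: norm1_delta.
  move=> _ [v /= v1 <-].
  by have := norm1_mulmx_le v Aj0; rewrite v1 mulr1.
apply: ub_le_sup.
  exists (\sum_i `|A i j0|) => _ [v /= v1 <-].
  by have := norm1_mulmx_le v Aj0; rewrite v1 mulr1.
by exists (delta_mx j0 0); [exact: norm1_delta | exact: norm1_mulmx_delta].
Qed.

(** For [n = 0] no vector has norm 1 and [sup] is 0, whereas the empty maximum is [-oo]. *)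
Lemma induced_norm1E (R : realType) (n : nat) (A : 'M[R]_n) :
  (0 < n)%N ->
  (induced_norm1 A)%:E = (\big[maxe/-oo]_j (\sum_i `|A i j|)%:E)%E.
Proof.
case: n A => // n A _.
have [j _ jmax] := @eq_bigmax _ _ _ -oo%E ord0 predT
  (fun j => (\sum_i `|A i j|)%:E) isT (fun _ _ => leNye _).
rewrite (@induced_norm1_eq_max _ _ _ j) ?jmax // => k.
by rewrite -lee_fin -jmax; exact: le_bigmax.
Qed.

Lemma bigmaxe_enum_val (R : realType) (I : finType) (A : {set I})
    (F : I -> \bar R) :
  (\big[maxe/-oo]_(i in A) F i = \big[maxe/-oo]_(k < #|A|) F (enum_val k))%E.
Proof.
apply/le_anti/andP; split.
  apply: bigmax_le => [|i iA]; first exact: leNye.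
  by rewrite -(enum_rankK_in iA iA); exact: le_bigmax.
apply: bigmax_le => [|k _]; first exact: leNye.
exact: (le_bigmax_cond _ _ (enum_valP k)).
Qed.

(* The partial sums equal (1 - P^n)(1 - P)^-1, so they are bounded; being
   nondecreasing they converge, which forces P^n to vanish. *)
Lemma neumann_series (R : realType) (n : nat) (P : 'M[R]_n) :
  (forall l a b, 0 <= (P ^+ l) a b <= 1) -> 1%:M - P \in unitmx ->
  forall a b, series (fun l => (P ^+ l) a b) @ \oo --> invmx (1%:M - P) a b.
Proof.
move=> P01 Pu.
pose N := invmx (1%:M - P).
have serE l a b :
    series (fun l => (P ^+ l) a b) l = N a b - \sum_c (P ^+ l) a c * N c b.
  have -> : series (fun l => (P ^+ l) a b) l = (\sum_(k < l) P ^+ k) a b.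
    by rewrite summxE /series /= big_mkord.
  have -> : \sum_(k < l) P ^+ k = N - P ^+ l *m N.
    rewrite -[LHS]mulmx1 -(mulmxV Pu) mulmxA -/N.
    have -> : (\sum_(k < l) P ^+ k) *m (1%:M - P) = 1%:M - P ^+ l.
      elim: l => [|l IH]; first by rewrite big_ord0 mul0mx expr0 subrr.
      rewrite big_ord_recr mulmxDl IH mulmxBr mulmx1 exprSr.
      by rewrite addrA subrK.
    by rewrite mulmxBl mul1mx.
  by rewrite !mxE.
have cvP a b : (P ^+ l) a b @[l --> \oo] --> 0.
  apply: cvg_series_cvg_0; apply: nondecreasing_is_cvgn.
    by apply: nondecreasing_series => k _ _; have /andP[] := P01 k a b.
  (* This bound is uniform in [l] because the entries of [P ^+ l] are at most 1. *)
  exists (`|N a b| + \sum_c `|N c b|) => _ [l _ <-].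
  rewrite serE; apply: (le_trans (ler_norm _)).
  apply: (le_trans (ler_normB _ _)); rewrite lerD2l.
  apply: (le_trans (ler_norm_sum _ _ _)); apply: ler_sum => c _.
  have /andP[p0 p1] := P01 l a c.
  by rewrite normrM ler_piMl // ger0_norm.
move=> a b.
rewrite (_ : series _ = fun l => N a b - \sum_c (P ^+ l) a c * N c b);
  last first.
  by apply/funext => l; exact: serE.
rewrite -[X in _ --> X]subr0; apply: cvgB; first exact: cvg_cst.
rewrite -[X in _ --> X](_ : \sum_(c < n) 0 * N c b = _); last first.
  by rewrite big1 // => c _; rewrite mul0r.
elim: (index_enum _) => [|c s IH].
  by under eq_fun do rewrite big_nil; rewrite big_nil; exact: cvg_cst.
under eq_fun do rewrite big_cons; rewrite big_cons.
by apply: cvgD => //; apply: cvgM => //; exact: cvg_cst.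
Qed.

(** * Probabilities and integrals for the chain and the stopped process *)

(** Measurability of [f] is not assumed, so the integral is taken as a supremum over simple
    functions below [f]. Each of them vanishes off the null set [N]. *)
Lemma ge0_integral_null_support d (T : measurableType d) (R : realType)
    (mu : {measure set T -> \bar R}) (N : set T) (f : T -> \bar R) :
  measurable N -> mu N = 0%E -> (forall x, (0 <= f x)%E) ->
  (forall x, ~ N x -> f x = 0%E) -> (\int[mu]_x f x = 0)%E.
Proof.
move=> mN N0 f0 fN; rewrite ge0_integralTE //.
apply/le_anti/andP; split; last first.
  by rewrite -ge0_integralTE //; exact: integral_ge0.
apply: ge_ereal_sup => _ [h /= hf <-].
rewrite -integralT_nnsfun (@ge0_negligible_integral _ _ _ _ _ N) //=.
- rewrite integral0_eq // => x [_ Nx]; apply/le_anti/andP; split.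
    by rewrite -(fN x Nx).
  by rewrite lee_fin fun_ge0.
- apply/measurable_EFinP; exact: measurable_funPT.
- by move=> x _; rewrite lee_fin fun_ge0.
Qed.

Lemma probability_finite_partition d (T : measurableType d) (R : realType)
    (P : probability T R) (F : finType) (g : T -> F) (A : set T) :
  (forall f, measurable (g @^-1` [set f])) -> measurable A ->
  fine (P A) = \sum_f fine (P (A `&` g @^-1` [set f])).
Proof.
move=> mg mA.
have mAg f : measurable (A `&` g @^-1` [set f]) by exact: measurableI.
have {1}-> : A = \bigcup_(f in [set: F]) (A `&` g @^-1` [set f]).
  by apply/seteqP; split=> [x Ax|x [f _ []]] //; exists (g x).
rewrite measure_fin_bigcup //; last 2 first.
- exact: finite_finset.
- by move=> f f' _ _ [x [[_ /= <-] [_ /= <-]]].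
rewrite (@fsbigE _ _ _ _ _ (enum F)) ?enum_uniq //=; last first.
  by move=> f _ /=; rewrite mem_enum.
rewrite big_enum_cond /= -sum_fine => [|f _]; last exact: fin_num_measure.
by apply: eq_bigl => f; rewrite in_setT.
Qed.

(** The Markov property is given for complete pasts. Summing over the finitely many trajectories up
    to time [l] yields the one-step recursion for the law. *)
Lemma markov_chain_step (R : realType) d (Omega : measurableType d) (K : nat)
    (T : 'M[R]_K) (Q : 'I_K -> probability Omega R)
    (Y : nat -> Omega -> 'I_K) (i : 'I_K) (l : nat) (j : 'I_K) :
  markov_chain T Q Y ->
  fine (Q i (Y l.+1 @^-1` [set j])) =
  \sum_k fine (Q i (Y l @^-1` [set k])) * T k j.
Proof.
case=> mY _ step.
pose g w : {ffun 'I_l.+1 -> 'I_K} := [ffun k : 'I_l.+1 => Y k w].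
have gE f : g @^-1` [set f] =
    [set w | forall k, (k <= l)%N -> Y k w = f (inord k)].
  apply/seteqP; split=> w /=.
    by move=> <- k kl; rewrite ffunE inordK.
  move=> Yf; apply/ffunP => k; rewrite ffunE Yf ?inord_val //.
  by rewrite -ltnS.
have mg f : measurable (g @^-1` [set f]).
  rewrite (_ : _ @^-1` _ =
    \bigcap_(k in [set k | (k <= l)%N]) (Y k @^-1` [set f (inord k)])).
    by apply: bigcap_measurable => [|k _]; [exists 0%N | exact: mY].
  by rewrite gE; apply/seteqP; split.
rewrite (probability_finite_partition _ mg) //.
under [RHS]eq_bigr => k _.
  rewrite (probability_finite_partition _ mg) // mulr_suml; over.
rewrite exchange_big; apply: eq_bigr => f _ /=.
rewrite setIC {1}gE step -gE fineM ?fin_num_measure //=.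
(* On the trajectory [f] the state at time [l] is [f (inord l)]; every other [k] gives an empty
   event. *)
rewrite (bigD1 (f (inord l))) //= big1 ?addr0.
  congr (fine (Q i _) * _).
  by rewrite setIC; apply/esym/setIidPl; rewrite gE => w; exact.
move=> k kf; rewrite (_ : _ `&` _ = set0) ?measure0 ?mul0r //.
rewrite gE; apply/seteqP; split=> // w [/= Yk /(_ l (leqnn l))].
by rewrite Yk => /eqP; rewrite (negbTE kf).
Qed.

(* The process started in [S k] is almost surely in [S k] at time 0, so it is
   stopped at once.  The integrand is not known to be measurable. *)
Lemma stopped_transition_absorbing (R : realType) (d d1 : measure_display)
  (X : measurableType d) (Omega : measurableType d1)
  (p : R.-pker X ~> X) (Pr : R.-pker X ~> Omega) (Z : nat -> Omega -> X)
  (K : nat) (S : 'I_K -> set X) (D : set X)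
  (dx : {measure set X -> \bar R}) (rho : X -> R) (t : nat) (k j : 'I_K) :
  markov_process p Pr Z -> measurable (S k) ->
  S k `<=` ~` D -> S j `<=` D ->
  stopped_transition dx rho S Pr Z D t k j = 0.
Proof.
case=> mZ Z0 _ mSk SkD SjD; rewrite !mxE /Rintegral integral0_eq ?mul0r //.
move=> x _; rewrite indicE; have [/set_mem xk|] := boolP (x \in S k);
  last by rewrite !mul0r.
rewrite (_ : stopped_operator _ _ _ _ _ _ = 0) ?mulr0 ?mul0r //.
rewrite /stopped_operator /Rintegral.
rewrite (@ge0_integral_null_support _ _ _ _ (Z 0%N @^-1` ~` S k)) //.
- rewrite -[X in measurable X]setTI; apply: mZ => //; exact: measurableC.
- rewrite Z0; last exact: measurableC.
  by rewrite diracE memNset //= => /(_ xk).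
move=> w /contrapT Zk.
have Dw : ~ D (Z 0%N w) by exact: SkD.
(* Time 0 is already a hit, which excludes [None] and makes the minimum 0. *)
rewrite /hitting_time; case: pselect => [h|[]]; last by exists 0%N; apply/asboolP.
case: ex_minnP => m _ /(_ 0%N) m0 /=.
have /eqP -> : m == 0%N by rewrite -leqn0 m0 //; exact/asboolP.
by rewrite minn0 indicE memNset // => /SjD.
Qed.

Lemma markov_chain_init (R : realType) d (Omega : measurableType d) (K : nat)
    (T : 'M[R]_K) (Q : 'I_K -> probability Omega R)
    (Y : nat -> Omega -> 'I_K) (i j : 'I_K) :
  markov_chain T Q Y -> Q i (Y 0%N @^-1` [set j]) = (i == j)%:R%:E.
Proof.
case=> mY Y0 _; have [<-|/eqP ij] := eqVneq i j; first exact: Y0.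
apply/le_anti/andP; split; last exact: measure_ge0.
(* The event lies in the complement of an event of probability 1. *)
rewrite -[leRHS](subee (x := 1)) // -[X in (_ <= _ - X)%E](Y0 i).
rewrite -probability_setC //; apply: le_measure; rewrite ?inE //.
  exact: measurableC.
by move=> w /= -> /esym.
Qed.

(** Mass that has left [I] cannot return, so only intermediate states in [I] contribute to the
    recursion for states in [I]. *)
Lemma markov_chain_restrict_pow (R : realType) d (Omega : measurableType d)
    (K : nat) (T : 'M[R]_K) (Q : 'I_K -> probability Omega R)
    (Y : nat -> Omega -> 'I_K) (I : {set 'I_K}) (l : nat) (a b : 'I_#|I|) :
  markov_chain T Q Y ->
  (forall k j, k \notin I -> j \in I -> T k j = 0) ->
  (restrict_mx I T ^+ l) a b =
  fine (Q (enum_val a) (Y l @^-1` [set enum_val b])).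
Proof.
move=> hY TI; elim: l b => [|l IH] b.
  rewrite expr0 (markov_chain_init _ _ hY) /= mxE.
  by rewrite (inj_eq enum_val_inj).
rewrite exprSr mxE (markov_chain_step _ _ _ hY) (bigID (mem I)) /=.
rewrite [X in _ = _ + X]big1 ?addr0; last first.
  by move=> k kI; rewrite TI ?mulr0 // enum_valP.
by rewrite [RHS]big_enum_val; apply: eq_bigr => c _; rewrite IH !mxE.
Qed.

(** Nonnegativity lets integral and series be exchanged; the integral of each indicator is then a
    probability. *)
Lemma expected_visits (R : realType) d (Omega : measurableType d) (K : nat)
    (P : probability Omega R) (Y : nat -> Omega -> 'I_K) (j : 'I_K) (c : R) :
  (forall l, measurable (Y l @^-1` [set j])) ->
  series (fun l => fine (P (Y l @^-1` [set j]))) @ \oo --> c ->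
  (\int[P]_w (\sum_(0 <= l <oo) (\1_[set j] (Y l w))%:E) = c%:E)%E.
Proof.
move=> mY cvc.
rewrite integral_nneseries //; last first.
  move=> l; apply/measurable_EFinP.
  exact: (measurable_indic (mY l)).
rewrite (_ : (fun n => \sum_(0 <= l < n) _)%E =
  EFin \o series (fun l => fine (P (Y l @^-1` [set j])))).
  apply: cvg_lim => //; apply: cvg_EFin; first exact: nearW.
  exact: cvc.
apply/funext => n /=; rewrite /series /= -sumEFin; apply: eq_bigr => l _.
rewrite fineK ?fin_num_measure //.
by rewrite (integral_indic _ measurableT (mY l)) setIT.
Qed.

Theorem mainTheorem2 (R : realType) (d d1 d2 : measure_display)
  (X : measurableType d) (Omega : measurableType d1)
  (p : R.-pker X ~> X) (Pr : R.-pker X ~> Omega) (Z : nat -> Omega -> X)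
  (hZ : markov_process p Pr Z)
  (K : nat) (S : 'I_K -> set X) (hS : measurable_partition S)
  (D : set X) (hD : forall i, S i `<=` D \/ S i `<=` ~` D)
  (dx : {measure set X -> \bar R}) (rho : X -> R)
  (hrho : probability_density dx rho)
  (hmu : forall i, 0 < state_weight dx rho S i)
  (hD0 : domain_states S D != finset.set0)
  (t : nat) (ht : (0 < t)%N)
  (hinv : restrict_mx (domain_states S D)
            (stopped_correlation dx rho S Pr Z D t - correlation0 dx rho S)
          \in unitmx)
  (Omega' : measurableType d2) (Q : 'I_K -> probability Omega' R)
  (Y : nat -> Omega' -> 'I_K)
  (hY : markov_chain (stopped_transition dx rho S Pr Z D t) Q Y) :
  (induced_norm1
    (invmx (restrict_mx (domain_states S D)
      (stopped_correlation dx rho S Pr Z D t - correlation0 dx rho S))))%:E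
  = (\big[maxe/-oo]_(j in domain_states S D)
      ((state_weight dx rho S j)^-1%:E *
       \sum_(i in domain_states S D)
         \int[Q i]_w (\sum_(0 <= l <oo) (\1_[set j] (Y l w))%:E)))%E.
Proof.
have [mY _ _] := hY.
have [mS _ _] := hS.
set I := domain_states S D in hD0 hinv *.
set C := stopped_correlation _ _ _ _ _ _ _ in hinv *.
set T := stopped_transition _ _ _ _ _ _ _ in hY.
set mu := state_weight dx rho S in hmu *.
have absorbing k j : k \notin I -> j \in I -> T k j = 0.
  rewrite !inE => /asboolPn kD jD.
  apply: (stopped_transition_absorbing _ _ _ hZ) => //.
  by case: (hD k).
pose P := restrict_mx I T.
have PE l a b := markov_chain_restrict_pow l a b hY absorbing.
have P01 l a b : 0 <= (P ^+ l) a b <= 1.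
  rewrite PE fine_ge0 //= -lee_fin fineK ?fin_num_measure //.
  exact: probability_le1.
pose m : 'rV[R]_#|I| := \row_a mu (enum_val a).
(* Positive weights give back the entries of [C] as [mu] times those of [T]. *)
have ME : restrict_mx I (C - correlation0 dx rho S) =
    - (diag_mx m *m (1%:M - P)).
  apply/matrixP => a b; rewrite mul_diag_mx !mxE.
  rewrite (inj_eq enum_val_inj) mulrBr [mu _ * (_ / _)]mulrC divfK ?lt0r_neq0 //.
  by rewrite opprB mulr_natr.
(* The factorization turns the assumed inverse into a left inverse of [1%:M - P], which suffices for
   square matrices. *)
have Pu : 1%:M - P \in unitmx.
  have := mulVmx hinv; rewrite {2}ME mulmxN -mulNmx mulmxA.
  by case/mulmx1_unit.
pose N := invmx (1%:M - P).
have cvN := neumann_series P01 Pu.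
(* Entries of [N] are limits of sums of nonnegative terms. *)
have N0 a b : 0 <= N a b.
  rewrite -(cvg_lim _ (cvN a b)) //; apply: limr_ge; first exact: cvgP (cvN a b).
  apply: nearW => l; apply: sumr_ge0 => k _.
  by have /andP[] := P01 k a b.
have invE a b : `|invmx (restrict_mx I (C - correlation0 dx rho S)) a b| =
    (mu (enum_val b))^-1 * N a b.
  have Mu := hinv; rewrite ME in Mu *.
  pose w : 'rV[R]_#|I| := \row_a (mu (enum_val a))^-1.
  have mw : diag_mx m *m diag_mx w = 1%:M.
    rewrite mulmx_diag -diag_const_mx; congr diag_mx.
    by apply/rowP => c; rewrite !mxE mulfV ?lt0r_neq0.
  (* An explicit right inverse must equal [invmx]; as [N] and [mu] are nonnegative, the absolute
     value only removes its sign. *)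
  have XE : - (diag_mx m *m (1%:M - P)) *m - (N *m diag_mx w) = 1%:M.
    by rewrite mulNmx mulmxN opprK -mulmxA (mulmxA (_ - _)) mulmxV ?mul1mx.
  rewrite -[invmx _]mulmx1 -[X in _ *m X]XE mulmxA mulVmx // mul1mx.
  by rewrite mul_mx_diag !mxE normrN normrM ger0_norm // mulrC
    gtr0_norm ?invr_gt0.
rewrite bigmaxe_enum_val induced_norm1E ?card_gt0 //.
apply: eq_bigr => b _; under eq_bigr do rewrite invE.
rewrite -mulr_sumr EFinM -sumEFin [in RHS]big_enum_val; congr (_ * _)%E.
apply: eq_bigr => a _; rewrite (@expected_visits _ _ _ _ _ _ _ (N a b)) //.
under eq_fun do rewrite -PE; exact: cvN.
Qed.
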